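(* Let $k>1$ be a natural number and let $n\ge 1$ be a multiple of $k$. Then the rank of the edge-vertex incidence matrix $B_{C_n^k}$ of the $k$-uniform cycle $C_n^k$ is at most $n-k+1$.
   Context: A hypergraph $H$ is a pair $(V(H),E(H))$ with $V(H)$ a non-empty set (vertices) and $E(H)$ a set of non-empty subsets of $V(H)$ (hyperedges). The edge-vertex incidence matrix $B_H=[b_{ev}]_{e\in E(H),v\in V(H)}$ (considered over $\mathbb{C}$) has $b_{ev}=1$ if $v\in e$ and $b_{ev}=0$ otherwise. For $k\ge 2$ and $n\ge k$, the $k$-uniform cycle $C_n^k$ is the hypergraph with vertex set $\mathbb{Z}_n$ (integers modulo $n$) and hyperedge set $\{e_i: i\in\mathbb{Z}_n\}$, where $e_i=\{i,i+1,\ldots,i+(k-1)\}$ with addition in $\mathbb{Z}_n$. *)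

(* Defs.v *)
From HB Require Import structures.
From mathcomp Require Import all_boot all_order all_algebra.
From mathcomp Require Import complex reals.

Set Implicit Arguments.
Unset Strict Implicit.
Unset Printing Implicit Defensive.

Import GRing.Theory.

Local Open Scope ring_scope.

(* Only finite hypergraphs: these are the ones whose incidence matrix is a
   MathComp matrix. The edges form a set, so there are no repeated edges. *)
Record hypergraph := Hypergraph {
  vertex : finType;
  edges : {set {set vertex}};
  vertex_nonempty : (0 < #|vertex|)%N;
  edges_nonempty : set0 \notin edges
}.

(* The rows (columns) are indexed through the enumeration of the edges
   (vertices), so coinciding edges contribute a single row. *)
Definition incidence_mx (F : fieldType) (H : hypergraph) :
    'M[F]_(#|edges H|, #|vertex H|) :=
  \matrix_(e < #|edges H|, v < #|vertex H|) (enum_val v \in enum_val e)%:R.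

Definition cycle_edge (k n : nat) (i : 'Z_n) : {set 'Z_n} :=
  [set i + (j : nat)%:R | j : 'I_k].

Definition cycle_edges (k n : nat) : {set {set 'Z_n}} :=
  [set cycle_edge k i | i : 'Z_n].

Lemma cycle_vertex_nonempty (n : nat) : (0 < #|'Z_n|)%N.
Proof. by rewrite card_ord. Qed.

Lemma cycle_edges_nonempty (k n : nat) (k_gt1 : (1 < k)%N) :
  set0 \notin cycle_edges k n.
Proof.
apply/imsetP => -[i _ /setP edge0].
have := edge0 (i + (Ordinal (ltnW k_gt1) : nat)%:R).
by rewrite inE => /esym/negP; apply; apply/imsetP; exists (Ordinal (ltnW k_gt1)).
Qed.

(* 'Z_n is the ring of integers modulo n only for n > 1, which the two
   hypotheses ensure. *)
Definition uniform_cycle (k n : nat) (k_gt1 : (1 < k)%N) (le_kn : (k <= n)%N) :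
    hypergraph :=
  @Hypergraph 'Z_n (cycle_edges k n)
    (cycle_vertex_nonempty n) (cycle_edges_nonempty n k_gt1).

(* Main.v *)
Require Import Defs.
From HB Require Import structures.
From mathcomp Require Import all_boot all_order all_algebra.
From mathcomp Require Import complex reals.

(** Colour the vertex [v] of the cycle by its residue modulo [k]; this makes
    sense on the integers modulo [n] because [k] divides [n]. The [k]
    consecutive vertices of an edge carry each of the [k] colours exactly once
    ([card_cycle_edge_color]). For any hypergraph with such a colouring and at
    least one edge, let [B] be the incidence matrix and [N] the matrix whose
    columns are the indicators of the colour classes. The [k] columns of [N]
    are linearly independent, while [B *m N] is the all-ones matrix, of rank at
    most 1. Sylvester's inequality [\rank B + \rank N <= n + \rank (B *m N)]
    then gives the bound ([rank_incidence_rainbow]). In terms of the kernel: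
    the differences of the indicators of two colour classes span a space of
    dimension [k - 1] that [B] annihilates. *)

Set Implicit Arguments.
Unset Strict Implicit.
Unset Printing Implicit Defensive.

Import GRing.Theory.

Local Open Scope ring_scope.

Definition color_class_mx (F : fieldType) (T : finType) (m : nat)
    (c : T -> 'I_m) : 'M[F]_(#|T|, m) :=
  \matrix_(v < #|T|, r < m) (c (enum_val v) == r)%:R.

(** Picking one vertex [s r] of each colour [r] selects rows of the class
    matrix that form the identity, whence the full rank. *)
Lemma rank_color_class_mx (F : fieldType) (T : finType) (m : nat)
    (c : T -> 'I_m) (s : 'I_m -> T) :
  cancel s c -> \rank (color_class_mx F c) = m.
Proof.
move=> sK; apply/eqP; rewrite eqn_leq rank_leq_col /=.
rewrite -[X in (X <= _)%N](mxrank1 F m).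
have -> : 1%:M = rowsub (enum_rank \o s) (color_class_mx F c).
  by apply/matrixP => r t; rewrite !mxE /= enum_rankK sK.
by rewrite rowsubE mxrankM_maxr.
Qed.

Lemma incidence_mul_color_class_mx (F : fieldType) (H : hypergraph) (m : nat)
    (c : vertex H -> 'I_m) e r :
  (incidence_mx F H *m color_class_mx F c) e r =
  #|[set v in enum_val e | c v == r]|%:R.
Proof.
rewrite -[in RHS]sum1_card natr_sum mxE.
under [LHS]eq_bigr do rewrite !mxE -natrM mulnb.
rewrite -(big_enum_val (fun v => ((v \in enum_val e) && (c v == r))%:R)).
rewrite [RHS]big_mkcond; apply: eq_bigr => v _.
by rewrite inE; case: (_ && _).
Qed.

(** A colouring whose colours all appear exactly once on each edge identifies
    the sum of the columns of the incidence matrix over one colour class with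
    that over any other. As soon as there is an edge, these are [m - 1]
    independent column relations. *)
Lemma rank_incidence_rainbow (F : fieldType) (H : hypergraph) (m : nat)
    (c : vertex H -> 'I_m) :
  (forall e, e \in edges H -> forall r, #|[set v in e | c v == r]| = 1%N) ->
  (\rank (incidence_mx F H) <= #|vertex H| - m + 1)%N.
Proof.
move=> rainbow; have [edges0 | [e eH]] := set_0Vmem (edges H).
  by apply: leq_trans (rank_leq_row _) _; rewrite edges0 cards0.
(* A single edge already shows all colours, so every class has a
   representative. *)
have /fin_all_exists[s sK] r : exists v, c v = r.
  have /card_gt0P[v] : (0 < #|[set v in e | c v == r]|)%N by rewrite rainbow.
  by rewrite inE => /andP[_ /eqP]; exists v.
have := mxrank_mul_min (incidence_mx F H) (color_class_mx F c).
rewrite (rank_color_class_mx F sK).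
have -> : incidence_mx F H *m color_class_mx F c =
          const_mx 1 *m (const_mx 1 : 'M_(1, m)).
  apply/matrixP => f r; rewrite incidence_mul_color_class_mx.
  by rewrite rainbow ?enum_valP // !mxE big_ord1 !mxE mulr1.
move=> /leq_trans /(_ (leq_trans (mxrankM_maxr _ _) (rank_leq_row _))).
have le_mV : (m <= #|vertex H|)%N.
  by have := leq_card s (can_inj sK); rewrite card_ord.
by rewrite leq_subLR addnBAC // leq_subRL ?(leq_trans le_mV) ?leq_addr // addnC.
Qed.

Definition residue (k n : nat) (k_gt0 : (0 < k)%N) (i : 'Z_n) : 'I_k :=
  Ordinal (ltn_pmod i k_gt0).

(** The edge starting at [i] meets the residue class of [r] at [i + j] for the
    only [j < k] congruent to [r - i] modulo [k]. *)
Lemma card_cycle_edge_color (k n : nat) (k_gt0 : (0 < k)%N) (n_gt1 : (1 < n)%N)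
    (i : 'Z_n) (r : 'I_k) :
  (k %| n)%N -> #|[set v in cycle_edge k i | residue k_gt0 v == r]| = 1%N.
Proof.
move=> k_dvd_n.
have residueD (j : nat) : residue k_gt0 (i + j%:R) = ((i + j) %% k)%N :> nat.
  by rewrite /= val_Zp_nat // [X in (_ %% X %% _)%N]Zp_cast // modnDmr modn_dvdm.
pose j0 := Ordinal (ltn_pmod (r + (k - i %% k))%N k_gt0).
have residue_j0 (j : 'I_k) : (residue k_gt0 (i + (j : nat)%:R) == r) = (j == j0).
  rewrite -(inj_eq val_inj) [val (residue _ _)]residueD -(inj_eq val_inj) /=.
  (* Both sides are congruences modulo [k]; adding [k - i] to both terms of the
     left one turns it into the right one. *)
  rewrite -{1}(modn_small (ltn_ord r)) -{2}(modn_small (ltn_ord j)).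
  rewrite -(eqn_modDr (k - i %% k)%N (i + j)%N r).
  rewrite addnAC -modnDml -(modnDml i).
  by rewrite subnKC ?modnn // ltnW // ltn_pmod.
rewrite -[RHS](cards1 (i + (j0 : nat)%:R)); congr #|pred_of_set _|.
apply/setP => v; rewrite !inE.
apply/andP/eqP => [[/imsetP[j _ ->]] | ->].
  by rewrite residue_j0 => /eqP->.
by rewrite residue_j0 eqxx; split=> //; apply: imset_f.
Qed.

Theorem proposition2p6 (R : realType) (k n : nat)
    (k_gt1 : (1 < k)%N) (n_gt0 : (0 < n)%N) (k_dvd_n : (k %| n)%N) :
  (\rank (incidence_mx R[i]
            (uniform_cycle k_gt1 (dvdn_leq n_gt0 k_dvd_n))) <= n - k + 1)%N.
Proof.
have n_gt1 : (1 < n)%N := leq_trans k_gt1 (dvdn_leq n_gt0 k_dvd_n).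
have -> : (n - k + 1 = #|'Z_n| - k + 1)%N by rewrite card_ord Zp_cast.
pose color := residue (ltnW k_gt1) : 'Z_n -> 'I_k.
apply: (@rank_incidence_rainbow _ (uniform_cycle _ _) _ color).
by move=> _ /imsetP[i _ ->] r; apply: card_cycle_edge_color.
Qed.
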